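(* Let $\pi$ be a layered pattern (a layered word, possibly with repeated letters) each of whose layers is order-isomorphic either to a strictly decreasing word $k\,(k-1)\cdots 1$ or to a constant word $1\,1\cdots 1$ (the lengths may vary from layer to layer). Let $\pi'$ be the layered permutation whose sequence of layer lengths equals that of $\pi$. If $\pi'$ is simple, then $\delta(\pi)=\delta(\pi')$.
   Context: $[k]=\{1,\dots,k\}$ and $[k]^n$ is the set of words of length $n$ over $[k]$; permutations in $S_n$ are regarded as words in $[n]^n$. Two words $u,v$ of the same length are order-isomorphic if for all positions $i,j$: $u_i<u_j\iff v_i<v_j$. For a pattern $\pi\in[l]^m$ and a word $\sigma\in[k]^n$, $n\ge m$, $\nu(\pi,\sigma)$ is the number of subsequences of $\sigma$ (choices of positions $i_1<\dots<i_m$) order-isomorphic to $\pi$, and $d(\pi,\sigma)=\nu(\pi,\sigma)/\binom{n}{m}$. Let $\delta(\pi,k,n)=\max\{d(\pi,\sigma):\sigma\in[k]^n\}$. The packing density is $\delta(\pi)=\lim_{n\to\infty}\delta(\pi,n,n)=\lim_{n\to\infty}\lim_{k\to\infty}\delta(\pi,k,n)$ (the limit exists). Layered words: a word $\pi\in[l]^m$ is layered if $\pi=\pi_1\cdots\pi_r$ where the $\pi_i$ are nonempty non-increasing words and every letter of $\pi_i$ is less than every letter of $\pi_j$ whenever $i<j$; the (maximal) substrings $\pi_i$ are called the layers of $\pi$. A layered permutation is a layered word that is a permutation; its layers are then strictly decreasing, and it is determined by its sequence of layer lengths. Simple: a layered permutation $\rho$ with $r$ layers is simple if there is a sequence $\{\sigma_n\}$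 of layered permutations, $\sigma_n\in S_n$, such that every $\sigma_n$ has $r$ layers and $\lim_{n\to\infty}d(\rho,\sigma_n)=\delta(\rho)$. *)

(* Defs.v *)
From HB Require Import structures.
From mathcomp Require Import all_boot all_order all_algebra all_fingroup.
From mathcomp Require Import all_classical all_reals all_analysis.

Set Implicit Arguments.
Unset Strict Implicit.
Unset Printing Implicit Defensive.

Import Order.TTheory GRing.Theory Num.Theory.
Import numFieldNormedType.Exports.

(* A word of length n over [k] is an [n.-tuple 'I_k]: the letters are numbered
   0, .., k - 1 instead of 1, .., k, which changes no order relation. *)
Definition letters (k n : nat) (w : n.-tuple 'I_k) : seq nat :=
  [seq nat_of_ord x | x <- w].

Definition word_of_perm (n : nat) (s : 'S_n) : n.-tuple 'I_n :=
  [tuple s i | i < n].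

Definition order_iso (u v : seq nat) : bool :=
  (size u == size v) &&
  [forall i : 'I_(size u), forall j : 'I_(size u),
     (nth 0 u i < nth 0 u j)%N == (nth 0 v i < nth 0 v j)%N].

(* The strictly increasing m-tuples of positions are the choices
   i_1 < ... < i_m. *)
Definition occurrences (l m k n : nat) (p : m.-tuple 'I_l) (s : n.-tuple 'I_k)
    : nat :=
  #|[pred I : m.-tuple 'I_n |
      sorted ltn [seq nat_of_ord i | i <- I] &&
      order_iso [seq nat_of_ord (tnth s i) | i <- I] (letters p)]|.

Local Open Scope ring_scope.

(* Intended for m <= n; the value is 0 otherwise. *)
Definition density (R : realType) (l m k n : nat)
    (p : m.-tuple 'I_l) (s : n.-tuple 'I_k) : R :=
  (occurrences p s)%:R / ('C(n, m))%:R.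

(* Densities are nonnegative, so the initial value 0 only matters when there is
   no word at all, i.e. k = 0 < n. *)
Definition max_density (R : realType) (l m : nat) (p : m.-tuple 'I_l)
    (k n : nat) : R :=
  \big[Num.max/0]_(s : n.-tuple 'I_k) density R p s.

(* The sequence converges, since max_density R p n n is nonincreasing for
   n >= m and bounded below by 0. *)
Definition packing_density (R : realType) (l m : nat) (p : m.-tuple 'I_l) : R :=
  limn (fun n : nat => max_density R p n n).

(* [layering w ls]: w is layered, with sequence of layers ls.  There is at most
   one such ls, because w can only be cut at its strict ascents and must be cut
   at each of them. *)
Definition layering (w : seq nat) (ls : seq (seq nat)) : Prop :=
  [/\ flatten ls = w,
      all (fun u => u != [::]) ls,
      all (sorted geq) ls
    & pairwise (fun u v => allrel ltn u v) ls].

(* There is no permutation of size n with more than n layers, so the condition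
   on s n is imposed only when n is at least the number of layers of rho. *)
Definition simple_perm (R : realType) (m : nat) (rho : 'S_m) : Prop :=
  exists ls : seq (seq nat),
    layering (letters (word_of_perm rho)) ls /\
    exists s : forall n : nat, 'S_n,
      (forall n : nat, (size ls <= n)%N ->
         exists2 ls' : seq (seq nat),
           layering (letters (word_of_perm (s n))) ls' & size ls' = size ls) /\
      ((fun n : nat => density R (word_of_perm rho) (word_of_perm (s n)))
         @ \oo --> packing_density R (word_of_perm rho))%classic.

Definition decreasing_word (k : nat) : seq nat := rev (iota 1 k).

Definition constant_word (k : nat) : seq nat := nseq k 1%N.

(* Main.v *)
Require Import Defs.
From mathcomp Require Import all_boot all_order all_algebra all_fingroup.
From mathcomp Require Import all_classical all_reals all_analysis.
From mathcomp Require Import zify.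

Set Implicit Arguments.
Unset Strict Implicit.
Unset Printing Implicit Defensive.

Import Order.TTheory GRing.Theory Num.Theory.
Import numFieldNormedType.Exports.

(** Write [p'] for the layered permutation with the layer lengths of the layered
    pattern [p].  The two maximal densities over words of length [n] are trapped:
    for large [n],
      density p' (s n) <= max_density p n n <= max_density p' n n,
    where [s n] is the sequence of layered permutations witnessing that [p'] is
    simple, so both bounds tend to the packing density of [p'].

    Right inequality ([break_ties]).  In a word, order equal letters decreasingly
    from left to right.  The result is a permutation; an occurrence of [p] keeps
    its layers, its decreasing layers stay decreasing and its constant layers
    become decreasing, so it is now an occurrence of [p'].

    Left inequality ([occurrences_geq_permutation]).  If a layered permutation
    has no more layers than [p'], an occurrence of [p'] must send the [i]-th
    layer of [p'] into the [i]-th layer of the permutation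
    ([onto_homo_eq]).  Making constant each layer of the permutation whose
    counterpart in [p] is constant turns every occurrence of [p'] into an
    occurrence of [p].

    That the upper bound converges at all ([max_density_cvg]) is the usual
    averaging argument: the density of a pattern in a word of length [n + 1] is
    the mean of its densities in the [n + 1] words obtained by deleting one
    position, so the maximal density is nonincreasing in [n >= m]. *)

(** * Occurrences of patterns *)

Definition is_occurrence (l m k n : nat) (p : m.-tuple 'I_l) (s : n.-tuple 'I_k)
    (I : m.-tuple 'I_n) : bool :=
  sorted ltn [seq nat_of_ord i | i <- I] &&
  order_iso [seq nat_of_ord (tnth s i) | i <- I] (letters p).

Lemma is_occurrenceP (l m k n : nat) (p : m.-tuple 'I_l) (s : n.-tuple 'I_k)
    (I : m.-tuple 'I_n) :
  reflect ((forall a c : 'I_m, a < c -> tnth I a < tnth I c) /\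
           (forall a c : 'I_m, (tnth s (tnth I a) < tnth s (tnth I c)) =
                               (tnth p a < tnth p c)))
          (is_occurrence p s I).
Proof.
have nthI (a : 'I_m) : nth 0 [seq nat_of_ord i | i <- I] a = tnth I a.
  by rewrite (nth_map (tnth I a)) ?size_tuple // -tnth_nth.
have nths (a : 'I_m) :
    nth 0 [seq nat_of_ord (tnth s i) | i <- I] a = tnth s (tnth I a).
  by rewrite (nth_map (tnth I a)) ?size_tuple // -tnth_nth.
have nthp (a : 'I_m) : nth 0 (letters p) a = tnth p a.
  by rewrite (nth_map (tnth p a)) ?size_tuple // -tnth_nth.
have sizeI : size [seq nat_of_ord (tnth s i) | i <- I] = m.
  by rewrite size_map size_tuple.
have sizep : size (letters p) = m by rewrite size_map size_tuple.
apply: (iffP andP) => [[incI isoI]|[incI isoI]].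
  split=> a c.
    move=> ac; rewrite -!nthI.
    by apply: (sorted_ltn_nth ltn_trans) => //; rewrite inE size_map size_tuple.
  have /andP[_ /forallP] := isoI.
  move=> /(_ (cast_ord (esym sizeI) a)) /forallP.
  by move=> /(_ (cast_ord (esym sizeI) c)) /eqP; rewrite /= !nths !nthp.
split.
  apply/(sortedP 0) => i; rewrite size_map size_tuple => im.
  have := incI (Ordinal (ltnW im)) (Ordinal im) (ltnSn i).
  by rewrite -!nthI.
apply/andP; split; first by rewrite sizeI sizep.
apply/forallP => a; apply/forallP => c; apply/eqP.
have := isoI (cast_ord sizeI a) (cast_ord sizeI c).
by rewrite -!nths -!nthp.
Qed.

Lemma leq_occurrences (l1 l2 m k1 k2 n : nat)
    (p1 : m.-tuple 'I_l1) (p2 : m.-tuple 'I_l2)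
    (s1 : n.-tuple 'I_k1) (s2 : n.-tuple 'I_k2) :
  (forall I, is_occurrence p1 s1 I -> is_occurrence p2 s2 I) ->
  occurrences p1 s1 <= occurrences p2 s2.
Proof. by move=> sub; apply/subset_leq_card/fintype.subsetP => I; apply: sub. Qed.

(** Any comparison of positions by a numerical key is realised by a word over an
    alphabet with as many letters as positions: the letter at [i] counts the
    positions of smaller key, and [i] itself is never among them. *)
Lemma standardize (n : nat) (f : 'I_n -> nat) :
  exists s : n.-tuple 'I_n,
    forall i j, (tnth s i < tnth s j) = (f i < f j).
Proof.
pose rank i := #|[pred j | f j < f i]|.
have rank_lt i : rank i < n.
  rewrite -[X in _ < X](card_ord n) -(cardC [pred j | f j < f i]).
  rewrite -[X in X < _]addn0 ltn_add2l; apply/card_gt0P; exists i.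
  by rewrite !inE ltnn.
exists [tuple Ordinal (rank_lt i) | i < n] => i j; rewrite !tnth_mktuple /=.
case: (ltnP (f i) (f j)) => [fij|fji].
  apply/fintype.proper_card/properP; split.
    by apply/fintype.subsetP => x; rewrite !inE => /ltn_trans; apply.
  by exists i; rewrite !inE // ltnn.
apply/negbTE; rewrite -leqNgt; apply/subset_leq_card/fintype.subsetP => x.
by rewrite !inE => /leq_trans; apply.
Qed.

(** * Convergence of the maximal densities *)

Definition delete (k n : nat) (s : n.+1.-tuple 'I_k) (i : 'I_n.+1) :
    n.-tuple 'I_k :=
  [tuple tnth s (lift i j) | j < n].

Lemma ltn_lift (n : nat) (i : 'I_n.+1) (x y : 'I_n) :
  (lift i x < lift i y) = (x < y).
Proof. by rewrite !ltnNge /= leq_bump2. Qed.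

(** An occurrence that avoids the position [i] is the image under [lift i] of an
    occurrence in the word without that position. *)
Lemma occurrences_avoiding (l m k n : nat) (p : m.-tuple 'I_l)
    (s : n.+1.-tuple 'I_k) (i : 'I_n.+1) :
  #|[pred I : m.-tuple 'I_n.+1 | is_occurrence p s I && (i \notin I)]|
    <= occurrences p (delete s i).
Proof.
set A := [pred I | _].
pose B := [pred J : m.-tuple 'I_n | is_occurrence p (delete s i) J].
apply: (@leq_trans #|[seq map_tuple (lift i) J | J in B]|); last first.
  exact: leq_image_card.
apply/subset_leq_card/fintype.subsetP => I; rewrite inE => /andP[occI iI].
have /fin_all_exists[u uP] (a : 'I_m) : exists j, lift i j = tnth I a.
  have /unlift_some[j -> _] : i != tnth I a.
    by apply: contraNneq iI => ->; apply: mem_tnth.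
  by exists j.
have IE : I = map_tuple (lift i) [tuple u a | a < m].
  by apply: eq_from_tnth => a; rewrite tnth_map tnth_mktuple uP.
apply/fintype.imageP; exists [tuple u a | a < m] => //.
rewrite inE; apply/is_occurrenceP.
have [incI isoI] := is_occurrenceP _ _ _ occI; split=> a c.
  by move=> /incI; rewrite -!uP ltn_lift !tnth_mktuple.
by rewrite !tnth_mktuple !uP isoI.
Qed.

(** Double counting of the pairs of an occurrence and a position outside it: each
    occurrence avoids [n.+1 - m] positions. *)
Lemma sum_occurrences_delete (l m k n : nat) (p : m.-tuple 'I_l)
    (s : n.+1.-tuple 'I_k) :
  (n.+1 - m) * occurrences p s <= \sum_i occurrences p (delete s i).
Proof.
apply: (@leq_trans (\sum_i \sum_(I | is_occurrence p s I) (i \notin I))).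
  rewrite exchange_big /= mulnC -sum_nat_const; apply: leq_sum => I occI.
  have [incI _] := is_occurrenceP _ _ _ occI.
  have uniqI : uniq I.
    apply/tuple_uniqP => a c eqI; apply: val_inj => /=.
    by case: (ltngtP a c) => // /incI; rewrite eqI ltnn.
  have -> : \sum_(i < n.+1) (i \notin I : nat) = #|[predC I]|.
    rewrite -sum1_card [RHS]big_mkcond; apply: eq_bigr => i _.
    by rewrite inE; case: (i \in I).
  have := cardC (mem I); rewrite (card_uniqP uniqI) size_tuple card_ord.
  by rewrite leq_subLR => ->.
apply: leq_sum => i _; apply: leq_trans (occurrences_avoiding p s i).
rewrite -sum1_card big_mkcond [X in _ <= X]big_mkcond; apply: leq_sum => I _ /=.
by rewrite inE /=; case: is_occurrence; case: (i \notin I).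
Qed.

Lemma density_le_max (R : realType) (l m k n : nat) (p : m.-tuple 'I_l)
    (s : n.-tuple 'I_k) : (density R p s <= max_density R p k n)%R.
Proof. exact: le_bigmax. Qed.

Lemma max_density_ge0 (R : realType) (l m k n : nat) (p : m.-tuple 'I_l) :
  (0 <= max_density R p k n)%R.
Proof. exact: bigmax_ge_id. Qed.

Lemma le_max_density (R : realType) (l1 l2 m n : nat)
    (p1 : m.-tuple 'I_l1) (p2 : m.-tuple 'I_l2) :
  (forall s1 : n.-tuple 'I_n, exists s2 : n.-tuple 'I_n,
     forall I, is_occurrence p1 s1 I -> is_occurrence p2 s2 I) ->
  (max_density R p1 n n <= max_density R p2 n n)%R.
Proof.
move=> sub; apply: bigmax_le => [|s1 _]; first exact: max_density_ge0.
have [s2 /leq_occurrences le12] := sub s1.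
apply: le_trans (density_le_max R p2 s2).
by rewrite ler_wpM2r ?invr_ge0 // ler_nat.
Qed.

(** Averaging over the deleted position, with
    [(n.+1 - m) * 'C(n.+1, m) = n.+1 * 'C(n, m)].  A shortened word still has
    letters below [n.+1]; standardizing it brings them below [n]. *)
Lemma max_density_decr (R : realType) (l m n : nat) (p : m.-tuple 'I_l) :
  m <= n -> (max_density R p n.+1 n.+1 <= max_density R p n n)%R.
Proof.
move=> mn; apply: bigmax_le => [|s _]; first exact: max_density_ge0.
set D := max_density R p n n.
have binn : (0 < 'C(n, m)%:R :> R)%R by rewrite ltr0n bin_gt0.
have binS : (0 < 'C(n.+1, m)%:R :> R)%R by rewrite ltr0n bin_gt0 leqW.
have del_le i : ((occurrences p (delete s i))%:R <= D * 'C(n, m)%:R)%R.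
  have [q qE] := standardize (fun j => tnth (delete s i) j : nat).
  rewrite -ler_pdivrMr //; apply: le_trans (density_le_max R p q).
  rewrite ler_pM2r ?invr_gt0 // ler_nat; apply: leq_occurrences => I.
  move=> /is_occurrenceP[incI isoI]; apply/is_occurrenceP; split=> // a c.
  by rewrite qE.
rewrite /density ler_pdivrMr // -(@ler_pM2l _ (n.+1 - m)%:R%R); last first.
  by rewrite ltr0n subn_gt0 ltnS.
rewrite mulrCA -!natrM -mul_bin_down [X in (_ <= D * X)%R]natrM mulrCA
  mulr_natl.
apply: (@le_trans _ _ (\sum_i occurrences p (delete s i))%:R%R).
  by rewrite ler_nat sum_occurrences_delete.
rewrite natr_sum; apply: le_trans (ler_sum _ (fun i _ => del_le i)) _.
by rewrite sumr_const card_ord.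
Qed.

Lemma max_density_cvg (R : realType) (l m : nat) (p : m.-tuple 'I_l) :
  cvgn (fun n => max_density R p n n).
Proof.
apply: (@near_nonincreasing_is_cvgn _ _ 0%R); last first.
  by apply: nearW => n; apply: max_density_ge0.
exists m => // n /= mn k nk.
rewrite -(subnK nk); elim: (k - n) => [|d]; first by rewrite lexx.
by apply: le_trans; rewrite addSn max_density_decr // (leq_trans mn) ?leq_addl.
Qed.

(** * Layers as a function of the position *)

(** The rank, in the sequence of layers [ls], of the layer that contains position
    [i] of [flatten ls].  It depends only on the lengths of the layers, hence is
    common to the pattern and its associated permutation. *)
Definition layer_index (ls : seq (seq nat)) (i : nat) : nat :=
  reshape_index (shape ls) i.

Lemma leq_layer_index (ls : seq (seq nat)) (i j : nat) :
  i <= j -> layer_index ls i <= layer_index ls j.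
Proof. by rewrite (reshape_leq (shape ls)) /= -!/(layer_index _ _); lia. Qed.

Section Layering.

Variables (w : seq nat) (ls : seq (seq nat)).
Hypothesis w_layers : layering w ls.

Lemma layering_size : sumn (shape ls) = size w.
Proof. by have [<-] := w_layers; rewrite size_flatten. Qed.

Lemma layer_index_lt (i : nat) : i < size w -> layer_index ls i < size ls.
Proof.
by rewrite -layering_size -[size ls](size_map size) => /reshape_indexP.
Qed.

Lemma layer_offset_lt (i : nat) : i < size w ->
  reshape_offset (shape ls) i < size (nth [::] ls (layer_index ls i)).
Proof.
move=> iw; rewrite -(nth_map _ 0) ?layer_index_lt //.
by apply: reshape_offsetP; rewrite layering_size.
Qed.

Lemma layer_index_onto (k : nat) : k < size ls ->
  exists2 i, i < size w & layer_index ls i = k.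
Proof.
have [_ /all_nthP nonempty _ _] := w_layers => kr.
have ne : 0 < nth 0 (shape ls) k.
  by rewrite (nth_map [::]) // lt0n size_eq0 nonempty.
exists (flatten_index (shape ls) k 0); last exact: flatten_indexKl.
by rewrite -layering_size flatten_indexP.
Qed.

Lemma layering_lt (i j : nat) : i < size w -> j < size w ->
  layer_index ls i < layer_index ls j -> nth 0 w i < nth 0 w j.
Proof.
move=> iw jw ij; have [<- _ _ /(pairwiseP [::]) incr] := w_layers.
rewrite !nth_flatten.
have /allrelP := incr _ _ (layer_index_lt iw) (layer_index_lt jw) ij.
by apply; apply: mem_nth; apply: layer_offset_lt.
Qed.

Lemma layering_geq (i j : nat) : i <= j -> j < size w ->
  layer_index ls i = layer_index ls j -> nth 0 w j <= nth 0 w i.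
Proof.
move=> ij jw eqij; have [wE _ /(all_nthP [::]) decr _] := w_layers.
rewrite -wE !nth_flatten -!/(layer_index _ _) eqij.
have := ij; rewrite (reshape_leq (shape ls)) /= -!/(layer_index _ _) eqij ltnn eqxx /=.
move=> offij; apply: (sorted_leq_nth _ _ _ (decr _ (layer_index_lt jw))) => //.
- by move=> x y z; rewrite /geq /= => xy zx; apply: leq_trans zx xy.
- by move=> x; rewrite /geq /=.
- by rewrite inE -eqij layer_offset_lt // (leq_ltn_trans ij).
- by rewrite inE layer_offset_lt.
Qed.

(** Letters do not increase within a layer, so an ascent from left to right has
    to leave its layer. *)
Lemma layering_ascent (i j : nat) : i < j -> j < size w ->
  nth 0 w i < nth 0 w j -> layer_index ls i < layer_index ls j.
Proof.
move=> ij jw wij; rewrite ltnNge; apply/negP => ji.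
have eqij : layer_index ls i = layer_index ls j.
  by apply/eqP; rewrite eqn_leq ji leq_layer_index // ltnW.
by have := layering_geq (ltnW ij) jw eqij; rewrite leqNgt wij.
Qed.

End Layering.

Definition is_decreasing (u : seq nat) : bool :=
  order_iso u (decreasing_word (size u)).

Lemma decreasing_or_constant_lt (u : seq nat) (k : nat) :
  order_iso u (decreasing_word k) \/ order_iso u (constant_word k) ->
  forall x y, x < size u -> y < size u ->
    (nth 0 u x < nth 0 u y) = is_decreasing u && (y < x).
Proof.
move=> u_type.
have sizeu : k = size u.
  by case: u_type => /andP[/eqP-> _]; rewrite ?size_rev ?size_iota ?size_nseq.
rewrite {}sizeu -/(is_decreasing u) in u_type.
have decr : is_decreasing u -> forall x y, x < size u -> y < size u ->
    (nth 0 u x < nth 0 u y) = (y < x).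
  move=> /andP[_ /forallP decr] x y xu yu.
  have /forallP/(_ (Ordinal yu))/eqP/= -> := decr (Ordinal xu).
  by rewrite /decreasing_word !nth_rev ?size_iota // !nth_iota; lia.
move=> x y xu yu; have [/decr-> //|notdecr] := boolP (is_decreasing u).
case: u_type => [|/andP[_ /forallP const]]; first by rewrite (negbTE notdecr).
have /forallP/(_ (Ordinal yu))/eqP/= -> := const (Ordinal xu).
by rewrite /constant_word !nth_nseq xu yu ltnn.
Qed.

(** The order of the letters is determined by the lengths of the layers and by
    which of them are decreasing; this is all that occurrences depend on.  A
    layer of length one counts as decreasing, harmlessly, as it has no two
    positions to compare. *)
Lemma layering_typed_lt (w : seq nat) (ls : seq (seq nat)) (i j : nat) :
  layering w ls ->
  (forall u : seq nat, u \in ls -> exists k : nat,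
     order_iso u (decreasing_word k) \/ order_iso u (constant_word k)) ->
  i < size w -> j < size w ->
  (nth 0 w i < nth 0 w j) =
  (layer_index ls i < layer_index ls j) ||
  [&& layer_index ls i == layer_index ls j,
      is_decreasing (nth [::] ls (layer_index ls i)) & j < i].
Proof.
move=> w_layers w_type iw jw.
case: (ltngtP (layer_index ls i) (layer_index ls j)) => [ij|ji|eqij] /=.
- exact: layering_lt w_layers _ _ iw jw ij.
- by apply/negbTE; rewrite -leqNgt ltnW // (layering_lt w_layers jw iw ji).
have [k u_type] := w_type _ (mem_nth [::] (layer_index_lt w_layers iw)).
have off_i := layer_offset_lt w_layers iw.
have off_j := layer_offset_lt w_layers jw.
rewrite -eqij in off_j.
have [wE _ _ _] := w_layers.
rewrite -wE !nth_flatten -!/(layer_index _ _) -eqij.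
rewrite (decreasing_or_constant_lt u_type) //; congr (_ && _).
rewrite [j < i]ltnNge (reshape_leq (shape ls) i j) /=.
rewrite -!/(layer_index _ _) eqij ltnn eqxx /=.
by rewrite ltnNge.
Qed.

Lemma layering_inj_lt (w : seq nat) (ls : seq (seq nat)) (i j : nat) :
  layering w ls -> uniq w -> i < size w -> j < size w ->
  (nth 0 w i < nth 0 w j) =
  (layer_index ls i < layer_index ls j) ||
  ((layer_index ls i == layer_index ls j) && (j < i)).
Proof.
move=> w_layers w_uniq iw jw.
case: (ltngtP (layer_index ls i) (layer_index ls j)) => [ij|ji|eqij] /=.
- exact: layering_lt w_layers _ _ iw jw ij.
- by apply/negbTE; rewrite -leqNgt ltnW // (layering_lt w_layers jw iw ji).
case: (leqP i j) => [ij|ji].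
  by rewrite ltnNge (layering_geq w_layers ij jw eqij).
rewrite ltn_neqAle (layering_geq w_layers (ltnW ji) iw (esym eqij)) andbT.
by rewrite nth_uniq //; lia.
Qed.

(** Choosing one point in each fibre of [b] up to [b x] gives a chain of [b x + 1]
    points on which [c] strictly increases from at least [0]. *)
Lemma onto_homo_leq (T : Type) (r : nat) (b c : T -> nat) :
  (forall k, k < r -> exists x, b x = k) ->
  (forall x y, b x < b y -> c x < c y) ->
  forall x, b x < r -> b x <= c x.
Proof.
move=> onto bc x bx; have [k kE] : exists k, k = b x by exists (b x).
elim: k x bx kE => [|k IH] x bx kE; first by rewrite -kE.
have [y by_] := onto k (ltac:(lia)).
have : b y <= c y by apply: IH; lia.
have := bc y x; lia.
Qed.

(** The only strictly increasing map from [0, r) to itself is the identity.  Hence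
    when the [r] layers of one word are embedded, in order, into at most [r]
    layers of another, each goes to the layer of equal rank.  The upper bound on [c] is the lower bound for the
    reversed functions. *)
Lemma onto_homo_eq (T : Type) (r : nat) (b c : T -> nat) :
  (forall x, b x < r) -> (forall x, c x < r) ->
  (forall k, k < r -> exists x, b x = k) ->
  (forall x y, b x < b y -> c x < c y) ->
  forall x, c x = b x.
Proof.
move=> br cr onto bc x; apply/eqP; rewrite eqn_leq.
rewrite (onto_homo_leq onto bc) // andbT.
have : r.-1 - b x <= r.-1 - c x.
  apply: (@onto_homo_leq _ r (fun x => r.-1 - b x) (fun x => r.-1 - c x)).
  - move=> k kr; have [y yE] := onto (r.-1 - k) (ltac:(lia)).
    by exists y; lia.
  - by move=> y z; have := br y; have := br z; have := bc z y; have := cr y;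
       have := cr z; lia.
  - by have := br x; lia.
by have := br x; have := cr x; lia.
Qed.

(** * Passing between words and permutations *)

Lemma ltn_lex (n a b x y : nat) : x < n -> y < n ->
  (a * n + x < b * n + y) = (a < b) || ((a == b) && (x < y)).
Proof.
move=> xn yn; case: (ltngtP a b) => [ab|ba|->] /=; last by rewrite ltn_add2l.
  have := leq_mul2r n a.+1 b; rewrite ab orbT mulSn; lia.
have := leq_mul2r n b.+1 a; rewrite ba orbT mulSn; lia.
Qed.

(** Lexicographic comparison by the letter, then by decreasing position, breaks
    the ties of [s]; the hypothesis says that [p'] arises from [p] in the same
    way, and breaking ties commutes with taking subwords. *)
Lemma break_ties (l l' m n k : nat) (p : m.-tuple 'I_l) (p' : m.-tuple 'I_l') :
  (forall a c : 'I_m, (tnth p' a < tnth p' c) =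
     (tnth p a < tnth p c) || ((tnth p a == tnth p c) && (c < a))) ->
  forall s : n.-tuple 'I_k, exists q : n.-tuple 'I_n,
    forall I, is_occurrence p s I -> is_occurrence p' q I.
Proof.
move=> tie s.
have [q qE] := standardize (fun i => tnth s i * n.+1 + (n - i)).
exists q => I /is_occurrenceP[incI isoI]; apply/is_occurrenceP; split=> // a c.
rewrite qE ltn_lex ?ltnS ?leq_subr // tie isoI; congr (_ || (_ && _)).
  have := isoI a c; have := isoI c a; rewrite -val_eqE /=; lia.
have := ltn_ord (tnth I a); have := ltn_ord (tnth I c).
by case: (ltngtP a c) (incI a c) (incI c a) => [ac|ca|/val_inj->]; lia.
Qed.

Lemma nth_letters (k n : nat) (w : n.-tuple 'I_k) (i : 'I_n) :
  nth 0 (letters w) i = tnth w i.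
Proof. by rewrite (nth_map (tnth w i)) ?size_tuple // -tnth_nth. Qed.

Lemma size_letters (k n : nat) (w : n.-tuple 'I_k) : size (letters w) = n.
Proof. by rewrite size_map size_tuple. Qed.

Lemma uniq_perm_letters (n : nat) (s : 'S_n) : uniq (letters (word_of_perm s)).
Proof.
rewrite map_inj_uniq; last exact: val_inj.
by apply/tuple_uniqP => i j; rewrite !tnth_mktuple; apply: perm_inj.
Qed.

Section LayeredPattern.

Variables (l m : nat) (p : m.-tuple 'I_l) (ls : seq (seq nat)).
Variables (p' : 'S_m) (ls' : seq (seq nat)).
Hypothesis p_layers : layering (letters p) ls.
Hypothesis p_layer_type : forall u : seq nat, u \in ls -> exists k : nat,
  order_iso u (decreasing_word k) \/ order_iso u (constant_word k).
Hypothesis p'_layers : layering (letters (word_of_perm p')) ls'.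
Hypothesis same_shape : shape ls' = shape ls.

Let layer (a : 'I_m) : nat := layer_index ls a.

Lemma pattern_lt (a c : 'I_m) : (tnth p a < tnth p c) = (layer a < layer c) ||
  [&& layer a == layer c, is_decreasing (nth [::] ls (layer a)) & c < a].
Proof.
by rewrite -!nth_letters (layering_typed_lt p_layers p_layer_type) ?size_letters.
Qed.

Lemma permutation_lt (a c : 'I_m) :
  (tnth (word_of_perm p') a < tnth (word_of_perm p') c) =
  (layer a < layer c) || ((layer a == layer c) && (c < a)).
Proof.
rewrite -!nth_letters (layering_inj_lt p'_layers) ?size_letters //.
  by rewrite /layer_index same_shape.
exact: uniq_perm_letters.
Qed.

Lemma occurrences_leq_permutation (n k : nat) (s : n.-tuple 'I_k) :
  exists q : n.-tuple 'I_n,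
    forall I, is_occurrence p s I -> is_occurrence (word_of_perm p') q I.
Proof.
apply: break_ties => a c; rewrite -val_eqE /=.
have := pattern_lt a c; have := pattern_lt c a; have := permutation_lt a c.
case: (ltngtP (layer a) (layer c)) => [_|_|<-] /=; lia.
Qed.

Lemma layer_lt (a : 'I_m) : layer a < size ls.
Proof. by apply: (layer_index_lt p_layers); rewrite size_letters. Qed.

Lemma layer_onto (k : nat) : k < size ls -> exists a, layer a = k.
Proof.
move=> /(layer_index_onto p_layers)[i]; rewrite size_letters => im <-.
by exists (Ordinal im).
Qed.

(** Compares the layers given by simplicity with those of the pattern: one
    position per layer of [rs] yields an increasing subword of [p'], whose
    letters lie in distinct layers of [ls']. *)
Lemma permutation_layers_leq (rs : seq (seq nat)) :
  layering (letters (word_of_perm p')) rs -> size rs <= size ls.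
Proof.
move=> rs_layers.
case E : (size rs) => [//|r].
have [i] := layer_index_onto rs_layers (k := r) (ltac:(lia)).
rewrite size_letters => im iE; pose b (a : 'I_m) := layer_index rs a.
suff : b (Ordinal im) <= layer (Ordinal im).
  have := layer_lt (Ordinal im); rewrite [b _]iE; lia.
apply: (@onto_homo_leq _ (size rs)).
- move=> k /(layer_index_onto rs_layers)[j]; rewrite size_letters => jm <-.
  by exists (Ordinal jm).
- move=> a c ac.
  have : tnth (word_of_perm p') a < tnth (word_of_perm p') c.
    by rewrite -!nth_letters (layering_lt rs_layers) ?size_letters.
  rewrite permutation_lt => /orP[//|/andP[_ ca]].
  by have := leq_layer_index rs (ltnW ca); rewrite leqNgt ac.
- by rewrite [b _]iE E.
Qed.

(** The key compares layers first.  Inside a layer it decreases with the position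
    or is constant, according to the type of the layer of [p] with the same
    rank. *)
Lemma occurrences_geq_permutation (n : nat) (s : 'S_n) (rs : seq (seq nat)) :
  layering (letters (word_of_perm s)) rs -> size rs <= size ls ->
  exists q : n.-tuple 'I_n, forall I,
    is_occurrence (word_of_perm p') (word_of_perm s) I -> is_occurrence p q I.
Proof.
move=> s_layers rs_le; pose c (i : 'I_n) := layer_index rs i.
have [q qE] := standardize (fun i => c i * n.+1 +
  (if is_decreasing (nth [::] ls (c i)) then n - i else 0)).
exists q => I /is_occurrenceP[incI isoI].
(* The occurrence maps each layer of the pattern into the layer of equal rank. *)
have cE : forall a, c (tnth I a) = layer a.
  apply: (onto_homo_eq layer_lt _ layer_onto) => [a|a d ad].
    by apply: leq_trans rs_le; rewrite (layer_index_lt s_layers) ?size_letters.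
  have ltad : a < d.
    by rewrite ltnNge; apply/negP => /(leq_layer_index ls); rewrite leqNgt ad.
  apply: (layering_ascent s_layers); rewrite ?size_letters ?incI //.
  by rewrite !nth_letters isoI permutation_lt ad.
apply/is_occurrenceP; split=> // a d.
rewrite qE !cE pattern_lt ltn_lex; try by case: ifP => _; rewrite ltnS ?leq_subr.
congr (_ || _); case: eqP => [<-|//] /=; case: is_decreasing => //=.
have := ltn_ord (tnth I a); have := ltn_ord (tnth I d).
by case: (ltngtP a d) (incI a d) (incI d a) => [ad|da|/val_inj->]; lia.
Qed.

End LayeredPattern.

Theorem theorem2p6 (R : realType) (l m : nat) (p : m.-tuple 'I_l)
    (ls : seq (seq nat)) (p' : 'S_m) (ls' : seq (seq nat))
    (p_layers : layering (letters p) ls)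
    (p_layer_type : forall u : seq nat, u \in ls ->
       exists k : nat,
         order_iso u (decreasing_word k) \/ order_iso u (constant_word k))
    (p'_layers : layering (letters (word_of_perm p')) ls')
    (same_layer_lengths : map size ls' = map size ls)
    (p'_simple : simple_perm R p') :
  packing_density R p = packing_density R (word_of_perm p').
Proof.
have [rs [rs_layers [s [s_layers s_cvg]]]] := p'_simple.
apply: cvg_lim => //.
apply: (squeeze_cvgr (f :=
  fun n => density R (word_of_perm p') (word_of_perm (s n)))
  (h := fun n => max_density R (word_of_perm p') n n)) => //; last first.
  exact: max_density_cvg.
exists (size rs) => // n rs_n; apply/andP; split; last first.
  apply: le_max_density => q.
  by apply: (occurrences_leq_permutation p_layers p_layer_type p'_layers).
have [ts ts_layers tsE] := s_layers n rs_n.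
have ts_le : size ts <= size ls.
  rewrite tsE.
  exact: permutation_layers_leq p_layers p'_layers same_layer_lengths _
    rs_layers.
have [q sub] := occurrences_geq_permutation p_layers p_layer_type p'_layers
  same_layer_lengths ts_layers ts_le.
apply: le_trans (density_le_max R p q).
by rewrite ler_wpM2r ?invr_ge0 // ler_nat leq_occurrences.
Qed.
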